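(* Let $r<w$ be positive reals. There is an optimal (strictly $1$-competitive) deterministic online algorithm with $1$ advice bit for the $(n,k,r,w)$-Parity for Number of Hats problem.
   Context: A deterministic online algorithm with advice computes $y_i$ from an advice string $\phi$ and $x_1,\dots,x_i$, where $\phi$ is chosen by an Adviser who knows the whole input; it is $c$-competitive with advice complexity $b$ if there is $\alpha\ge 0$ such that for every input $I$ there is $\phi$ of at most $b$ bits with $cost\le c\cdot cost(Opt(I))+\alpha$ ($Opt$ an optimal offline algorithm); it is optimal if this holds with $c=1$, $\alpha=0$. For $X\in\{0,1\}^m$ with $\#_1(X)=v\cdot 2^k$, $v$ an integer, $PartialMOD_m^k(X)=v\bmod 2$. The $(n,k,r,w)$-Parity for Number of Hats problem: feasible inputs are $I=(2,X_1,2,X_2,2,X_3)$ of length $n=m_1+m_2+m_3+3$, with $m_i\ge 2^{k+1}$, $X_i\in\{0,1\}^{m_i}$, $\#_1(X_i)$ a multiple of $2^k$. Let $y_1,y_2,y_3$ be the output bits at the three requests with value $2$ and $z_j=\bigoplus_{i=j}^{3}PartialMOD_{m_i}^k(X_i)$. The cost is $r$ if $y_j=z_j$ for all $j$, and $w$ otherwise, with $r<w$. *)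

(* Defs.v *)
From HB Require Import structures.
From mathcomp Require Import all_boot all_order all_algebra.
From mathcomp Require Import reals.

Set Implicit Arguments.
Unset Strict Implicit.
Unset Printing Implicit Defensive.

Import Order.TTheory GRing.Theory Num.Theory.

(* Online minimization problems with requests in X, answers in Y and costs in
   R: the answer to an input of length n is a sequence of length n. *)
Record online_problem (R : realType) (X Y : Type) := OnlineProblem {
  feasible : seq X -> Prop;
  cost : seq X -> seq Y -> R
}.

(* [A phi [:: x_1; ...; x_i]] is the i-th answer under the advice phi. *)
Definition advice_algorithm (X Y : Type) := seq bool -> seq X -> Y.

Definition run (X Y : Type) (A : advice_algorithm X Y) (phi : seq bool)
    (I : seq X) : seq Y :=
  mkseq (fun i => A phi (take i.+1 I)) (size I).

Definition optimal_offline (R : realType) (X Y : Type)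
    (P : online_problem R X Y) (Opt : seq X -> seq Y) : Prop :=
  forall I, feasible P I ->
    size (Opt I) = size I /\
    forall O, size O = size I -> (cost P I (Opt I) <= cost P I O)%R.

(* All optimal offline algorithms have the same cost on feasible inputs, so
   the choice of Opt is immaterial; quantifying it existentially avoids a
   vacuous notion when no optimum is attained. *)
Definition competitive_with (R : realType) (X Y : Type)
    (P : online_problem R X Y) (b : nat) (c alpha : R)
    (A : advice_algorithm X Y) : Prop :=
  exists2 Opt, optimal_offline P Opt &
    forall I, feasible P I ->
      exists2 phi : seq bool, size phi <= b &
        (cost P I (run A phi I) <= c * cost P I (Opt I) + alpha)%R.

Definition optimal_with_advice (R : realType) (X Y : Type)
    (P : online_problem R X Y) (b : nat) (A : advice_algorithm X Y) : Prop :=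
  competitive_with P b 1%R 0%R A.

(* Meaningful when 2 ^ k divides the number of ones; the division is then
   exact. *)
Definition PartialMOD (k : nat) (X : seq nat) : bool :=
  odd (count_mem 1 X %/ 2 ^ k).

Definition hats_block (k : nat) (X : seq nat) : bool :=
  [&& all (mem [:: 0; 1]) X, 2 ^ k.+1 <= size X & 2 ^ k %| count_mem 1 X].

Definition hats_feasible (n k : nat) (I : seq nat) : Prop :=
  size I = n /\
  exists X1 X2 X3 : seq nat,
    I = 2 :: X1 ++ 2 :: X2 ++ 2 :: X3 /\
    [&& hats_block k X1, hats_block k X2 & hats_block k X3].

(* The maximal 2-free segments following each 2; this recovers [:: X1; X2; X3]
   from 2 :: X1 ++ 2 :: X2 ++ 2 :: X3. *)
Fixpoint blocks (I : seq nat) : seq (seq nat) :=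
  if I is x :: I' then
    if x == 2 then take (index 2 I') I' :: blocks I' else blocks I'
  else [::].

(* Indices start at 0: [hats_target k I j] is z_(j+1). *)
Definition hats_target (k : nat) (I : seq nat) (j : nat) : bool :=
  \big[addb/false]_(j <= i < 3) PartialMOD k (nth [::] (blocks I) i).

(* The answers given at the requests with value 2; the others are ignored. *)
Definition hats_answers (I : seq nat) (O : seq bool) : seq bool :=
  mask [seq x == 2 | x <- I] O.

Definition hats_cost (R : realType) (k : nat) (r w : R)
    (I : seq nat) (O : seq bool) : R :=
  if hats_answers I O == mkseq (hats_target k I) 3 then r else w.

Definition parity_number_of_hats (R : realType) (n k : nat) (r w : R) :
    online_problem R nat bool :=
  OnlineProblem (hats_feasible n k) (hats_cost k r w).

(* Main.v *)
Require Import Defs.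
From mathcomp Require Import all_boot all_order all_algebra.
From mathcomp Require Import reals.

(** The advice bit is [z_1].  Since [z_(j+1)] is [z_j] plus the parity of
    [X_j], and [X_j] is completely known when the [(j+1)]-st request 2 arrives,
    all the remaining answers can be computed online. *)

(** A prefix longer than [s] is [s] followed by a prefix of [t], so on [t] the algorithm acts as one
    that has [s] in its memory. *)
Lemma run_cat (X Y : Type) (A : advice_algorithm X Y) (phi : seq bool)
    (s t : seq X) :
  run A phi (s ++ t) =
  run A phi s ++ run (fun phi u => A phi (s ++ u)) phi t.
Proof.
rewrite /run /mkseq size_cat iotaD map_cat; congr (_ ++ _).
  apply/eq_in_map => i; rewrite mem_iota /= add0n => lt_i_s.
  by rewrite takel_cat.
rewrite add0n -[X in iota X]addn0 iotaDl -map_comp; apply: eq_map => i /=.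
by rewrite -addnS takeD take_size_cat // drop_size_cat.
Qed.

Lemma blocks_cat_no2 (X J : seq nat) : 2 \notin X -> blocks (X ++ J) = blocks J.
Proof.
elim: X => //= x X IH; rewrite in_cons negb_or eq_sym => /andP[/negPf-> X2].
exact: IH.
Qed.

Lemma blocks_cons_last (X : seq nat) : 2 \notin X -> blocks (2 :: X) = [:: X].
Proof.
move=> X2 /=; rewrite memNindex // take_size.
(* Appending [[::]] gives the shape needed to skip all of [X]. *)
by rewrite -[X in blocks X]cats0 blocks_cat_no2.
Qed.

Lemma blocks_cons_cat (X J : seq nat) : 2 \notin X ->
  blocks (2 :: X ++ 2 :: J) = X :: blocks (2 :: J).
Proof.
move=> X2; rewrite [LHS]/= index_cat (negPf X2) /= addn0 take_size_cat //.
by rewrite blocks_cat_no2.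
Qed.

Lemma hats_answers_block (X : seq nat) (a : bool) (O : seq bool) :
  2 \notin X -> hats_answers (2 :: X) (a :: O) = [:: a].
Proof.
rewrite /hats_answers /= => X2; congr cons.
(* [O] is generalized, as each request uses up one answer; its length is arbitrary. *)
elim: X X2 O => [|x X IH] //=; rewrite in_cons negb_or eq_sym.
by move=> /andP[/negPf-> X2] [|b O] //=; apply: IH.
Qed.

(** Peels off one block: only its leading 2 yields a relevant answer. As [A] is arbitrary, the lemma
    applies again to the algorithm that remembers this block. *)
Lemma hats_answers_run_block (A : advice_algorithm nat bool) (phi : seq bool)
    (X J : seq nat) : 2 \notin X ->
  hats_answers (2 :: X ++ J) (run A phi (2 :: X ++ J)) =
  A phi [:: 2] ::
    hats_answers J (run (fun phi u => A phi (2 :: X ++ u)) phi J).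
Proof.
move=> X2; rewrite -cat_cons run_cat {1}/hats_answers map_cat mask_cat.
  by rewrite -/(hats_answers (2 :: X) _) hats_answers_block //= take0.
by rewrite size_map size_mkseq.
Qed.

Lemma hats_block_no2 (k : nat) (X : seq nat) : hats_block k X -> 2 \notin X.
Proof. by case/and3P => /allP X01 _ _; apply/negP => /X01. Qed.

(* The prefixes at which the answer matters end with a request 2: their last
   block is empty and contributes [false]. *)
Definition hats_algorithm (k : nat) : advice_algorithm nat bool :=
  fun phi I =>
    head false phi (+) \big[addb/false]_(B <- blocks I) PartialMOD k B.

Lemma hats_algorithm_correct (n k : nat) (I : seq nat) : hats_feasible n k I ->
  hats_answers I (run (hats_algorithm k) [:: hats_target k I 0] I) =
  mkseq (hats_target k I) 3.
Proof.
case=> _ [X1 [X2 [X3 [-> /and3P[]]]]].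
move=> /hats_block_no2 N1 /hats_block_no2 N2 /hats_block_no2 N3.
have PMnil : PartialMOD k [::] = false by rewrite /PartialMOD /= div0n.
set phi := [:: _].
(* With an empty tail after [X3], the last block is peeled off like the others. *)
rewrite -{1 2}(cats0 X3) !hats_answers_run_block //.
rewrite /phi /hats_answers /hats_algorithm /hats_target /mkseq -[iota 0 3]/[:: 0; 1; 2].
rewrite !blocks_cons_cat // !blocks_cons_last //.
rewrite /index_iota /= !big_cons !big_nil PMnil.
(* The parities of the blocks already read cancel against those in [z_1], leaving [z_j]. *)
by do 3!case: (PartialMOD _ _).
Qed.

Theorem theorem11 (R : realType) (n k : nat) (r w : R)
    (r_gt0 : (0 < r)%R) (r_lt_w : (r < w)%R) :
  exists A : advice_algorithm nat bool,
    optimal_with_advice (parity_number_of_hats n k r w) 1 A.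
Proof.
exists (hats_algorithm k).
(* The algorithm with the correct bit serves as its own optimum: it costs [r], the smaller of the
   two possible values. *)
pose Opt I := run (hats_algorithm k) [:: hats_target k I 0] I.
have costOpt I : hats_feasible n k I -> hats_cost k r w I (Opt I) = r.
  by move=> fI; rewrite /hats_cost (hats_algorithm_correct _ _ _ fI) eqxx.
exists Opt => I fI.
  split=> [|O _]; first exact: size_mkseq.
  rewrite /= costOpt // /hats_cost; case: ifP => _ //.
  exact: Order.POrderTheory.ltW.
exists [:: hats_target k I 0] => //.
by rewrite GRing.mul1r GRing.addr0.
Qed.
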